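(* For every $w\in\mathbb{C}$, $x>0$ and $y\in\mathbb{R}$ such that $|y|<x$, the following holds: $$\sum_{n=1}^{+\infty}\frac{1}{n!}\Big(\sum_{k=1}^n\frac{n!(n-1)!}{(n-k)!k!(k-1)!}|y|^{n-k}|w|^k\Big)\frac{1}{x^n}<+\infty,$$ and $$\sum_{n=1}^{+\infty}(-1)^{n-1}\frac{1}{n!}\frac{w^n}{(x-y)^n}=\sum_{n=1}^{+\infty}(-1)^{n-1}\frac{1}{n!}\Big(\sum_{k=1}^n(-1)^{n-k}\frac{n!(n-1)!}{(n-k)!k!(k-1)!}y^{n-k}w^k\Big)\frac{1}{x^n}=\sum_{n=1}^{+\infty}(-1)^{n-1}\frac{1}{n!}\Lambda_n(w,y)\frac{1}{x^n}.$$
   Context: For $n\ge1$, $\Lambda_n(x,u)=\sum_{k=1}^n(-1)^{n-k}\frac{n!(n-1)!}{(n-k)!k!(k-1)!}x^ku^{n-k}$ is the two-variable homogeneous version of the (monic) generalized Laguerre polynomial of order $-1$. *)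

(* Defs.v *)
From Stdlib Require Import Reals Factorial.
From Coquelicot Require Import Coquelicot.

(** Series indexed from [N]: Coquelicot's [is_series] and [ex_series] start at
    index 0, so [\sum_{n >= N} a n] is taken along [n = N + m], [m >= 0]. *)
Definition is_series_from {K : AbsRing} {V : NormedModule K}
    (N : nat) (a : nat -> V) (s : V) : Prop :=
  is_series (fun m => a (N + m)%nat) s.

Definition ex_series_from {K : AbsRing} {V : NormedModule K}
    (N : nat) (a : nat -> V) : Prop :=
  ex_series (fun m => a (N + m)%nat).

(** n! (n-1)! / ((n-k)! k! (k-1)!).  The subtractions are truncated, hence
    meaningful only for [1 <= k <= n]. *)
Definition lag_coef (n k : nat) : R :=
  (INR (fact n) * INR (fact (n - 1))
   / (INR (fact (n - k)) * INR (fact k) * INR (fact (k - 1))))%R.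

(** Two-variable homogeneous version of the monic generalized Laguerre
    polynomial of order -1 and degree [n >= 1]. *)
Definition Lambda (n : nat) (x u : C) : C :=
  sum_n_m (fun k => (- (1)) ^ (n - k) * lag_coef n k * x ^ k * u ^ (n - k))%C
    1 n.

(* Main.v *)
Require Import Defs.
From Stdlib Require Import Reals Factorial Lra Lia.
From Coquelicot Require Import Coquelicot.

(** With c_k = (-1)^k w^(k+1) / (k+1)!, the two series are the two orders of
    summation of the double family C(n,k) y^(n-k) / x^(n+1) * c_k (k <= n):
    summing over n first gives c_k / (x-y)^(k+1) by the negative binomial series.
    The exchange is Tannery's theorem applied to the triangular partial sums; the
    dominating series is |c_k| / (x-|y|)^(k+1), an exponential series. Replacing
    w and y by their moduli in the same argument yields the absolute convergence. *)

(** [ring] and [field] do not recognise an equation whose type is a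
    canonical-structure carrier instead of [R] or [C]. *)
Ltac eq_in T := lazymatch goal with |- ?a = ?b => change (@eq T a b) end.

(** * Dominated convergence for sums of growing length *)

Lemma is_lim_seq_sum_n_0 (f : nat -> nat -> R) (m : nat) :
  (forall k, is_lim_seq (f k) 0) ->
  is_lim_seq (fun N => sum_n (fun k => f k N) m) 0.
Proof.
  intros Hf; induction m as [|m IH].
  - apply is_lim_seq_ext with (f O); [|apply Hf].
    intros N; now rewrite sum_O.
  - apply is_lim_seq_ext with (fun N => sum_n (fun k => f k N) m + f (S m) N)%R.
    + intros N; now rewrite sum_Sn.
    + replace (Finite 0) with (Finite (0 + 0)) by (f_equal; ring).
      now apply is_lim_seq_plus'.
Qed.

(** Tannery's theorem, for null sequences. *)
Lemma is_lim_seq_sum_n_dominated (f : nat -> nat -> R) (M : nat -> R) :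
  (forall k N, 0 <= f k N <= M k)%R ->
  ex_series M ->
  (forall k, is_lim_seq (f k) 0) ->
  is_lim_seq (fun N => sum_n (fun k => f k N) N) 0.
Proof.
  intros HfM [l Hl] Hf.
  assert (HM0 : forall k, (0 <= M k)%R).
  { intros k; destruct (HfM k O); lra. }
  assert (HM' : is_lim_seq (sum_n M) l) by exact Hl.
  apply is_lim_seq_spec; intros eps.
  assert (He : (0 < eps / 2)%R) by (generalize (cond_pos eps); lra).
  apply is_lim_seq_spec in HM'.
  destruct (HM' (mkposreal _ He)) as [K HK]; simpl in HK.
  generalize (is_lim_seq_sum_n_0 f K Hf); intros HF.
  apply is_lim_seq_spec in HF.
  destruct (HF (mkposreal _ He)) as [N0 HN0]; simpl in HN0.
  exists (N0 + K)%nat; intros N HN.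
  assert (Hpos : forall m, (0 <= sum_n (fun k => f k N) m)%R).
  { intros m; rewrite sum_n_Reals; apply cond_pos_sum; intros k; apply HfM. }
  (* The head up to [K] has fixed length, hence tends to zero; the tail is at most that of [M],
     which the choice of [K] makes smaller than [eps / 2]. *)
  assert (Hle : (sum_n (fun k => f k N) N
                 <= sum_n (fun k => f k N) K + (sum_n M N - sum_n M K))%R).
  { unfold sum_n.
    rewrite (sum_n_m_Chasles (fun k => f k N) 0 K N) by lia.
    rewrite (sum_n_m_Chasles M 0 K N) by lia.
    assert (H := sum_n_m_le (fun k => f k N) M (S K) N (fun k => proj2 (HfM k N))).
    change plus with Rplus; lra. }
  specialize (HN0 N ltac:(lia)).
  assert (H1 := HK K (le_n K)).
  assert (H2 : (sum_n M N <= l)%R).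
  { apply (is_lim_seq_incr_compare (sum_n M) l Hl).
    intros n; rewrite sum_Sn; change plus with Rplus; specialize (HM0 (S n)); lra. }
  rewrite Rminus_0_r in *.
  rewrite Rabs_pos_eq in * by apply Hpos.
  apply Rabs_lt_between in H1; lra.
Qed.

(** * Triangular summation of double families *)

(** Going from [N] to [S N] extends each column [k <= N] by one term and opens column [S N] with a
    single term; together these new terms form the diagonal of index [S N]. *)
Lemma sum_n_triangle {G : AbelianMonoid} (h : nat -> nat -> G) (N : nat) :
  sum_n (fun n => sum_n (fun k => h k (n - k)%nat) n) N
  = sum_n (fun k => sum_n (h k) (N - k)) N.
Proof.
  induction N as [|N IH].
  - now rewrite !sum_O.
  - rewrite (sum_Sn _ N), IH, !(sum_Sn _ N), plus_assoc.
    rewrite Nat.sub_diag, sum_O; f_equal.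
    unfold sum_n at 1 3 4; rewrite <- sum_n_m_plus.
    apply sum_n_m_ext_loc; intros k Hk.
    replace (S N - k)%nat with (S (N - k)) by lia.
    now rewrite sum_Sn.
Qed.

Lemma plus_minus_cancel {G : AbelianGroup} (a b : G) : plus (minus a b) b = a.
Proof. unfold minus; now rewrite <- plus_assoc, plus_opp_l, plus_zero_r. Qed.

(** Summed by columns, the triangular partial sum differs from [sum_n L N] by the sum [D N] of the
    column remainders. Each remainder tends to zero and is dominated through [M], so [D] tends to
    zero by Tannery's theorem. *)
Lemma is_series_triangle {K : AbsRing} {V : NormedModule K}
    (h : nat -> nat -> V) (L : nat -> V) (M : nat -> R) (s : V) :
  (forall k, is_series (h k) (L k)) ->
  (forall k m, (norm (sum_n (h k) m) <= M k)%R) ->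
  ex_series M ->
  is_series L s ->
  is_series (fun n => sum_n (fun k => h k (n - k)%nat) n) s.
Proof.
  intros Hh HM HMs HL.
  assert (Hnorm : forall k, is_lim_seq
            (fun m => norm (minus (sum_n (h k) m) (L k))) 0).
  { intros k. 
    replace (Finite 0) with (Finite (norm (minus (L k) (L k))))
      by (f_equal; rewrite minus_eq_zero; apply norm_zero).
    apply (filterlim_comp _ _ _ (fun m => minus (sum_n (h k) m) (L k)) norm
             eventually (locally (minus (L k) (L k)))); [|apply filterlim_norm].
    unfold minus.
    apply (filterlim_comp_2 (G := locally (L k)) (H := locally (opp (L k))));
      [apply Hh | apply filterlim_const | apply filterlim_plus]. }
  assert (HLM : forall k, (norm (L k) <= M k)%R).
  { intros k.
    apply (is_lim_seq_le (fun m => norm (sum_n (h k) m)) (fun _ => M k)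
             (norm (L k)) (M k)); [apply HM | | apply is_lim_seq_const].
    apply (filterlim_comp _ _ _ (sum_n (h k)) norm _ (locally (L k)));
      [apply Hh | apply filterlim_norm]. }
  set (D := fun N : nat => sum_n (fun k => minus (sum_n (h k) (N - k)) (L k)) N : V).
  assert (HD : filterlim D eventually (locally (@zero V))).
  { apply filterlim_norm_zero.
    apply (is_lim_seq_le_le (fun _ => 0%R) _
      (fun N => sum_n (fun k => norm (minus (sum_n (h k) (N - k)) (L k))) N) 0).
    - intros N; split; [apply norm_ge_0 | apply norm_sum_n_m].
    - apply is_lim_seq_const.
    (* The factor 2 arises because a remainder is a partial sum minus its limit, and [M k] bounds
       the norm of both. *)
    - apply (is_lim_seq_sum_n_dominated
        (fun k N => norm (minus (sum_n (h k) (N - k)) (L k)))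
        (fun k => scal 2 (M k))).
      + intros k N; split; [apply norm_ge_0|].
        unfold minus; eapply Rle_trans; [apply norm_triangle|].
        rewrite norm_opp; change scal with Rmult.
        specialize (HM k (N - k)%nat); specialize (HLM k); lra.
      + now apply (ex_series_scal (V := R_NormedModule)).
      (* For [N < k] the subtraction [N - k] is truncated to 0; shifting the sequence by [k]
         discards these terms. *)
      + intros k; apply (is_lim_seq_incr_n _ k).
        eapply is_lim_seq_ext; [|apply (Hnorm k)].
        intros N; simpl; now replace (N + k - k)%nat with N by lia. }
  unfold is_series.
  rewrite <- (plus_zero_l s).
  apply filterlim_ext with (fun N => plus (D N) (sum_n L N)).
  - intros N; rewrite sum_n_triangle; unfold D, sum_n.
    rewrite <- sum_n_m_plus; apply sum_n_m_ext; intros k.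
    apply (plus_minus_cancel (sum_n (h k) (N - k)) (L k)).
  - apply (filterlim_comp_2 (G := locally (@zero V)) (H := locally s));
      [exact HD | exact HL | apply filterlim_plus].
Qed.

(** * The negative binomial series *)

(** Hockey-stick identity, by Pascal's rule. *)
Lemma sum_binomial_diagonal (k n : nat) :
  sum_f_R0 (fun j => Binomial.C (k + j) k) n = Binomial.C (S k + n) (S k).
Proof.
  induction n as [|n IH].
  - simpl; rewrite Nat.add_0_r, !C_n_n; reflexivity.
  - rewrite tech5, IH.
    replace (k + S n)%nat with (S k + n)%nat by lia.
    replace (S k + S n)%nat with (S (S k + n)) by lia.
    rewrite <- (pascal (S k + n) k) by lia. ring.
Qed.

Lemma binomial_ge_0 (n k : nat) : (0 <= Binomial.C n k)%R.
Proof.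
  unfold Binomial.C; apply Rmult_le_pos; [apply pos_INR|].
  apply Rlt_le, Rinv_0_lt_compat, Rmult_lt_0_compat; apply INR_fact_lt_0.
Qed.

(** Each further factor [/ (1 - t)] is a Cauchy product with the geometric series, whose
    coefficients are the hockey-stick sums. *)
Lemma is_series_negative_binomial (k : nat) (t : R) :
  (Rabs t < 1)%R ->
  is_series (fun j => Binomial.C (k + j) k * t ^ j)%R (/ (1 - t) ^ S k)%R.
Proof.
  (* The induction hypothesis is also used at [Rabs t], for the absolute convergence that the Cauchy
     product requires. *)
  revert t; induction k as [|k IH]; intros t Ht.
  - rewrite pow_1; eapply is_series_ext; [|apply (is_series_geom t Ht)].
    intros j; simpl; rewrite C_n_0; simpl; ring.
  - assert (Ht' : (Rabs (Rabs t) < 1)%R) by now rewrite Rabs_Rabsolu.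
    assert (t <> 1)%R by (apply Rabs_lt_between in Ht; lra).
    replace (/ (1 - t) ^ S (S k))%R with (/ (1 - t) ^ S k * / (1 - t))%R
      by (simpl; field; split; [apply pow_nonzero|]; lra).
    eapply is_series_ext; [|apply (is_series_mult _ _ _ _ (IH t Ht) (is_series_geom t Ht))].
    + intros n. rewrite <- (sum_binomial_diagonal k n), Rmult_comm, scal_sum.
      apply sum_eq; intros j Hj.
      rewrite Rmult_assoc, <- pow_add. now replace (j + (n - j))%nat with n by lia.
    + eapply ex_series_ext; [|eexists; apply (IH (Rabs t) Ht')].
      intros j; simpl; rewrite Rabs_mult, <- RPow_abs.
      now rewrite (Rabs_pos_eq (Binomial.C _ _)) by apply binomial_ge_0.
    + eapply ex_series_ext; [|eexists; apply (is_series_geom (Rabs t) Ht')].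
      intros j; simpl; now rewrite RPow_abs.
Qed.

(** Take [t = y / x] and scale by [/ x ^ S k]. The resulting power of [x] depends on [k + j] only,
    so it is constant along the diagonals of the double family. *)
Lemma is_series_negative_binomial_expansion (k : nat) (x y : R) :
  (Rabs y < x)%R ->
  is_series (fun j => Binomial.C (k + j) k * y ^ j / x ^ S (k + j))%R
            (/ (x - y) ^ S k)%R.
Proof.
  intros Hy.
  assert (Hx : (0 < x)%R) by (generalize (Rabs_pos y); lra).
  assert (Hxy : (y < x)%R) by (apply Rabs_lt_between in Hy; lra).
  assert (Ht : (Rabs (y / x) < 1)%R).
  { unfold Rdiv; rewrite Rabs_mult, (Rabs_pos_eq (/ x)%R)
      by (apply Rlt_le, Rinv_0_lt_compat, Hx).
    apply (Rmult_lt_reg_r x); [exact Hx|]. field_simplify; lra. }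
  assert (H := is_series_scal (/ x ^ S k)%R _ _ (is_series_negative_binomial k _ Ht)).
  replace (/ (x - y) ^ S k)%R with (scal (/ x ^ S k)%R (/ (1 - y / x) ^ S k)%R).
  - eapply is_series_ext; [|exact H]. intros j; simpl.
    change scal with Rmult; cbv beta.
    change (S (k + j)) with (S k + j)%nat.
    unfold Rdiv; rewrite Rpow_mult_distr, pow_inv, pow_add.
    field; repeat split; try apply pow_nonzero; lra.
  - change scal with Rmult.
    rewrite <- Rinv_mult, <- Rpow_mult_distr. do 2 f_equal. field; lra.
Qed.

(** * The binomial transform of a series *)

Lemma is_series_ge_partial_sum (a : nat -> R) (l : R) (m : nat) :
  (forall n, 0 <= a n)%R -> is_series a l -> (sum_n a m <= l)%R.
Proof.
  intros Ha Hl.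
  apply (is_lim_seq_incr_compare (sum_n a) l Hl).
  intros n; rewrite sum_Sn; change plus with Rplus; specialize (Ha (S n)); lra.
Qed.

Lemma sum_n_scal_r {K : Ring} {V : ModuleSpace K} (a : nat -> K) (v : V) (m : nat) :
  sum_n (fun k => scal (a k) v) m = scal (sum_n a m) v.
Proof.
  induction m as [|m IH]; [now rewrite !sum_O|].
  now rewrite !sum_Sn, IH, scal_distr_r.
Qed.

Lemma is_series_scal_r {K : AbsRing} {V : NormedModule K}
    (a : nat -> K) (l : K) (v : V) :
  @is_series K (AbsRing_NormedModule K) a l -> is_series (fun n => scal (a n) v) (scal l v).
Proof.
  intros Ha; unfold is_series.
  apply filterlim_ext with (fun m => scal (sum_n a m) v).
  - intros m; symmetry; apply (sum_n_scal_r a v m).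
  - apply (filterlim_comp _ _ _ (sum_n a) (fun z => scal z v) eventually (locally l));
      [exact Ha | apply filterlim_scal_l].
Qed.

(** Column [k] is [c k] times the expansion of [/ (x - y) ^ S k] in powers of [y], and the
    triangular summation exchanges the two orders. Working in any real normed module covers both the
    moduli in [R] and the complex terms. *)
Lemma is_series_binomial_transform {V : NormedModule R_AbsRing}
    (c : nat -> V) (x y : R) (s : V) :
  (Rabs y < x)%R ->
  ex_series (fun k => norm (c k) / (x - Rabs y) ^ S k)%R ->
  is_series (fun k => scal (/ (x - y) ^ S k)%R (c k)) s ->
  is_series
    (fun n => sum_n (fun k =>
       scal (Binomial.C n k * y ^ (n - k) / x ^ S n)%R (c k)) n) s.
Proof.
  intros Hy Hc Hs.
  assert (Hx : (0 < x)%R) by (generalize (Rabs_pos y); lra).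
  set (b := fun k j => (Binomial.C (k + j) k * y ^ j / x ^ S (k + j))%R).
  (* Taking absolute values turns [y] into [Rabs y]; the terms are then nonnegative, so partial sums
     stay below the full sum. *)
  assert (Hb : forall k m, (Rabs (sum_n (b k) m) <= / (x - Rabs y) ^ S k)%R).
  { intros k m.
    set (b' := fun j => (Binomial.C (k + j) k * Rabs y ^ j / x ^ S (k + j))%R).
    assert (Hb' : forall j, Rabs (b k j) = b' j).
    { intros j; unfold b, b', Rdiv.
      rewrite !Rabs_mult, <- RPow_abs, Rabs_inv.
      rewrite (Rabs_pos_eq (Binomial.C _ _)) by apply binomial_ge_0.
      now rewrite (Rabs_pos_eq (x ^ _)) by (apply pow_le; lra). }
    apply Rle_trans with (sum_n b' m).
    - unfold sum_n; eapply Rle_trans; [apply (norm_sum_n_m (b k))|].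
      right; apply sum_n_m_ext; exact Hb'.
    - apply is_series_ge_partial_sum.
      + intros n; rewrite <- Hb'; apply Rabs_pos.
      + apply is_series_negative_binomial_expansion; now rewrite Rabs_Rabsolu. }
  apply is_series_ext with
    (fun n => sum_n (fun k => scal (b k (n - k)%nat) (c k)) n).
  { intros n; apply sum_n_m_ext_loc; intros k Hk; unfold b.
    now replace (k + (n - k))%nat with n by lia. }
  apply (is_series_triangle (fun k j => scal (b k j) (c k))
           (fun k => scal (/ (x - y) ^ S k)%R (c k))
           (fun k => norm (c k) / (x - Rabs y) ^ S k)%R); [| | exact Hc | exact Hs].
  - intros k; apply (is_series_scal_r (b k)).
    now apply is_series_negative_binomial_expansion.
  - intros k m.
    eapply Rle_trans; [right; apply (f_equal norm), (sum_n_scal_r (b k) (c k) m)|].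
    eapply Rle_trans; [apply (norm_scal (sum_n (b k) m) (c k))|].
    unfold Rdiv; rewrite Rmult_comm; apply Rmult_le_compat_l; [apply norm_ge_0|].
    apply Hb.
Qed.

(** * Exponential series, Laguerre coefficients and complex arithmetic *)

Lemma ex_series_exp_shift (z : R) :
  ex_series (fun k => z ^ S k / INR (fact (S k)))%R.
Proof.
  apply (ex_series_incr_1 (fun k => z ^ k / INR (fact k))%R).
  exists (exp z); eapply is_series_ext; [|apply (is_exp_Reals z)].
  intros n; simpl. rewrite pow_n_pow. reflexivity.
Qed.

(** With both indices shifted to start at 0, [fact (S n)] cancels the prefactor of the series,
    leaving a binomial transform with weights [/ INR (fact (S k))]. *)
Lemma lag_coef_binomial (n k : nat) :
  (k <= n)%nat ->
  lag_coef (S n) (S k)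
  = (INR (fact (S n)) * (Binomial.C n k / INR (fact (S k))))%R.
Proof.
  intros Hk; unfold lag_coef, Binomial.C; rewrite !Nat.sub_succ, !Nat.sub_0_r.
  field; repeat split; apply INR_fact_neq_0.
Qed.

Lemma sum_n_m_1_S {G : AbelianMonoid} (a : nat -> G) (n : nat) :
  sum_n_m a 1 (S n) = sum_n (fun k => a (S k)) n.
Proof. symmetry; apply sum_n_m_S. Qed.

(** The norm of [C] over [R] is a product norm, built on the absolute values of the components;
    squaring removes them. *)
Lemma norm_C_R (z : C) : @norm R_AbsRing C_R_NormedModule z = Cmod z.
Proof.
  unfold Cmod; rewrite <- (pow2_abs (fst z)), <- (pow2_abs (snd z)); reflexivity.
Qed.

Lemma RtoC_neq_0 (a : R) : a <> 0%R -> RtoC a <> 0%C.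
Proof. intros Ha E; apply Ha, RtoC_inj, E. Qed.

(** With [j = n - k], the two signs in the expanded series combine into one depending on [k] alone,
    which can be put into the coefficient [c k]. *)
Lemma Cpow_opp_1_cancel (k j : nat) :
  ((- (1)) ^ (k + j) * (- (1)) ^ j = (- (1)) ^ k)%C.
Proof.
  rewrite Cpow_add_r, <- Cmult_assoc, <- Cpow_mult_l.
  replace (- (1) * - (1))%C with (RtoC 1) by ring.
  rewrite Cpow_1_l; ring.
Qed.

(** * Absolute convergence and the common sum *)

Theorem proposition6p6 (w : C) (x y : R) (Hx : (0 < x)%R) (Hy : (Rabs y < x)%R) :
  ex_series_from 1
    (fun n : nat =>
       (1 / INR (fact n)
        * sum_n_m (fun k : nat => lag_coef n k * Rabs y ^ (n - k) * Cmod w ^ k)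
            1 n
        * (1 / x ^ n))%R)
  /\ exists s : C,
       is_series_from 1
         (fun n : nat =>
            ((- (1)) ^ (n - 1) * (1 / INR (fact n)) * (w ^ n / (x - y) ^ n))%C) s
       /\ is_series_from 1
            (fun n : nat =>
               ((- (1)) ^ (n - 1) * (1 / INR (fact n))
                * sum_n_m
                    (fun k : nat =>
                       (- (1)) ^ (n - k) * lag_coef n k * y ^ (n - k) * w ^ k)
                    1 n
                * (1 / x ^ n))%C) s
       /\ is_series_from 1
            (fun n : nat =>
               ((- (1)) ^ (n - 1) * (1 / INR (fact n))
                * Lambda n w y * (1 / x ^ n))%C) s.
Proof.
  (* [r] bounds [x - y] from below, so powers of [/ r] dominate those of [/ (x - y)]. [HE] is the
     exponential series at [Cmod w / r] without its constant term. *)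
  set (r := (x - Rabs y)%R).
  assert (Hr : (0 < r)%R) by (unfold r; lra).
  assert (Hxy : (r <= x - y)%R) by (unfold r; generalize (Rle_abs y); lra).
  assert (HE : ex_series (fun k => Cmod w ^ S k / INR (fact (S k)) / r ^ S k)%R).
  { eapply ex_series_ext; [|apply (ex_series_exp_shift (Cmod w / r))].
    intros k; unfold Rdiv; rewrite Rpow_mult_distr, pow_inv; simpl; ring. }
  assert (Hw : forall k, (0 <= Cmod w ^ S k / INR (fact (S k)))%R).
  { intros k; apply Rmult_le_pos; [apply pow_le, Cmod_ge_0|].
    apply Rlt_le, Rinv_0_lt_compat, INR_fact_lt_0. }
  split.
  - destruct HE as [s Hs]; exists s; unfold is_series_from.
    (* With [Rabs y] in place of [y], the series [HE] is both the dominating series and the one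
       being transformed, so its sum [s] is the witness. *)
    eapply is_series_ext;
      [|apply (is_series_binomial_transform (V := R_NormedModule)
          (fun k => Cmod w ^ S k / INR (fact (S k)))%R x (Rabs y) s)].
    + intros n; change (1 + n)%nat with (S n).
      rewrite sum_n_m_1_S.
      rewrite Rmult_assoc, (Rmult_comm (sum_n _ _)), <- Rmult_assoc.
      rewrite <- (sum_n_mult_l (K := R_Ring)).
      apply sum_n_m_ext_loc; intros k [_ Hk].
      rewrite lag_coef_binomial by exact Hk.
      change scal with Rmult; change mult with Rmult; rewrite Nat.sub_succ.
      eq_in R.
      field; repeat split; try apply pow_nonzero; try apply INR_fact_neq_0; lra.
    + now rewrite Rabs_Rabsolu.
    + rewrite Rabs_Rabsolu.
      exists s; eapply is_series_ext; [|exact Hs].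
      intros k; simpl; fold r. f_equal.
      symmetry; apply (Rabs_pos_eq _ (Hw k)).
    + eapply is_series_ext; [|exact Hs].
      intros k; fold r; apply Rmult_comm.
  - set (c := fun k => ((- (1)) ^ k * (1 / INR (fact (S k))) * w ^ S k)%C).
    assert (Hc : forall k, @norm R_AbsRing C_R_NormedModule (c k)
                           = (Cmod w ^ S k / INR (fact (S k)))%R).
    { intros k; rewrite norm_C_R; unfold c.
      rewrite !Cmod_mult, !Cmod_pow, Cmod_opp, Cmod_1, pow1.
      rewrite <- RtoC_div by apply INR_fact_neq_0.
      rewrite Cmod_R, Rabs_pos_eq.
      - field; apply INR_fact_neq_0.
      - apply Rlt_le, Rdiv_lt_0_compat; [lra | apply INR_fact_lt_0]. }
    assert (HcE : ex_series
      (fun k => @norm R_AbsRing C_R_NormedModule (c k) / (x - Rabs y) ^ S k)%R).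
    { eapply ex_series_ext; [|exact HE]. intros k; now rewrite Hc. }
    (* Completeness of [C] and the domination give convergence of the series in [/ (x - y)]; its sum
       [s] is the common value. *)
    destruct (ex_series_le (V := C_R_CompleteNormedModule)
      (fun k => @scal R_AbsRing C_R_NormedModule (/ (x - y) ^ S k)%R (c k))
      (fun k => @norm R_AbsRing C_R_NormedModule (c k) / (x - Rabs y) ^ S k)%R)
      with (2 := HcE) as [s Hs].
    { intros k.
      eapply Rle_trans; [apply (@norm_scal R_AbsRing C_R_NormedModule)|].
      unfold Rdiv; rewrite Rmult_comm.
      apply Rmult_le_compat_l; [apply norm_ge_0|].
      change abs with Rabs.
      rewrite Rabs_pos_eq by (apply Rlt_le, Rinv_0_lt_compat, pow_lt; lra).
      apply Rinv_le_contravar; [apply pow_lt; exact Hr|].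
      apply pow_incr; fold r; lra. }
    assert (HS := is_series_binomial_transform (V := C_R_NormedModule)
                    c x y s Hy HcE Hs).
    (* Series in [C] over [C] and over [R] are convertible, so [HS] can be used
       although the theorem's series live in [C_NormedModule]. *)
    assert (H2 : is_series_from 1
            (fun n : nat =>
               ((- (1)) ^ (n - 1) * (1 / INR (fact n))
                * sum_n_m
                    (fun k : nat =>
                       (- (1)) ^ (n - k) * lag_coef n k * y ^ (n - k) * w ^ k)
                    1 n
                * (1 / x ^ n))%C) s).
    { eapply (is_series_ext (K := R_AbsRing) (V := C_R_NormedModule)); [|exact HS].
      intros n; change (1 + n)%nat with (S n).
      rewrite sum_n_m_1_S.
      rewrite <- Cmult_assoc, (Cmult_comm (sum_n _ _)), Cmult_assoc.
      rewrite <- (sum_n_mult_l (K := C_Ring)).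
      apply (sum_n_m_ext_loc (G := Ring.AbelianMonoid C_Ring)); intros k [_ Hk].
      rewrite lag_coef_binomial by exact Hk.
      rewrite scal_R_Cmult; change mult with Cmult; unfold c.
      rewrite !Nat.sub_succ, Nat.sub_0_r.
      eq_in C.
      (* The sign inside [c k] is split back into the outer sign and the sign under the inner
         sum. *)
      rewrite <- (Cpow_opp_1_cancel k (n - k)).
      replace (k + (n - k))%nat with n by lia.
      unfold Rdiv; rewrite !RtoC_mult.
      rewrite !RtoC_inv, !RtoC_pow by (first [apply INR_fact_neq_0 | apply pow_nonzero; lra]).
      field; repeat split; first [apply Cpow_nz|idtac]; apply RtoC_neq_0;
        first [apply INR_fact_neq_0 | lra]. }
    exists s; repeat split.
    + eapply (is_series_ext (K := R_AbsRing) (V := C_R_NormedModule)); [|exact Hs].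
      intros k; change (1 + k)%nat with (S k).
      etransitivity; [apply scal_R_Cmult|]; unfold c.
      rewrite Nat.sub_succ, Nat.sub_0_r.
      eq_in C.
      rewrite RtoC_inv, RtoC_pow, RtoC_minus by (apply pow_nonzero; lra).
      unfold Cdiv; ring.
    + exact H2.
    + eapply is_series_ext; [|exact H2].
      intros n; cbv beta; do 2 f_equal; unfold Lambda.
      apply sum_n_m_ext; intros k; eq_in C; ring.
Qed.
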